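(* Let $\Omega=(S,\Sigma,\Pi)$ be a many-sorted signature, let $\mathcal{S}$ be a set of ground atoms over $\Omega$, let $\mathcal{I}=\mathcal{I}_{\mathcal{S}}$ be its initial model, and for every model $\mathcal{A}$ of $\mathcal{S}$ let $h=\{h_s:\mathcal{I}_s\to\mathcal{A}_s\}_{s\in S}$ be the unique $\Omega$-homomorphism from $\mathcal{I}$ to $\mathcal{A}$. Let $\varphi$ be a sentence of the form $$(Q_1 x_1:s_1)\cdots(Q_k x_k:s_k)\ \bigvee_{i=1}^m\bigwedge_{j=1}^{n_i} L_{ij},$$ where each $L_{ij}$ is a literal, $x_1,\ldots,x_k$ ($k\ge 0$) are the variables occurring in these literals, of sorts $s_1,\ldots,s_k$, and each $Q_q\in\{\forall,\exists\}$. Let $\mathcal{A}$ be a model of $\mathcal{S}$ such that (a) for every $q$ with $1\le q\le k$ and $Q_q=\forall$, the map $h_{s_q}$ is surjective; and (b) for every negative literal $L_{ij}=\neg P(t_1,\ldots,t_n)$ of $\varphi$, with $P\in\Pi_w$, and every substitution $\sigma$ mapping each variable to a ground term of its sort, if $h(\sigma(t_1),\ldots,\sigma(t_n))\in P^{\mathcal{A}}$ then $(\sigma(t_1),\ldots,\sigma(t_n))\in P^{\mathcal{I}}$. Then $\mathcal{I}_{\mathcal{S}}\models\varphi$ implies $\mathcal{A}\models\varphi$.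
   Context: Many-sorted first-order logic: a signature $\Omega=(S,\Sigma,\Pi)$ consists of a set $S$ of sorts, function symbols $f:s_1\cdots s_k\to s$ (constants when $k=0$), and predicate symbols $P\in\Pi_w$ with $w\in S^+$; if the identity predicate $=\,:ss$ is present, every structure interprets it as the identity on the carrier of sort $s$. An $\Omega$-structure $\mathcal{A}$ has a carrier $\mathcal{A}_s$ for each sort, a function $f^{\mathcal{A}}$ for each function symbol, and a relation $P^{\mathcal{A}}\subseteq\mathcal{A}_w$ for each predicate. An $\Omega$-homomorphism $h:\mathcal{A}\to\mathcal{A}'$ is a sort-indexed family of maps commuting with all function symbols and mapping tuples in $P^{\mathcal{A}}$ into $P^{\mathcal{A}'}$. The initial model $\mathcal{I}_{\mathcal{S}}$ of a set $\mathcal{S}$ of ground atoms has, for each sort $s$, the set of ground terms of sort $s$ modulo the least congruence $\sim$ generated by the ground equations in $\mathcal{S}$ (just the ground terms if $\mathcal{S}$ has no equations), function symbols interpreted syntactically, and $P^{\mathcal{I}}$ the set of tuples of classes of ground terms $(t_1,\ldots,t_n)$ such that $P(t'_1,\ldots,t'_n)\in\mathcal{S}$ for some $t'_i\sim t_i$. For any model $\mathcal{A}$ of $\mathcal{S}$ the unique homomorphism $h:\mathcal{I}_{\mathcal{S}}\to\mathcal{A}$ sends the class of a ground term $t$ to the value of $t$ in $\mathcal{A}$. For a substitution $\sigma$ of ground terms, $\sigma(t)$ is regarded as an element (class) of $\mathcal{I}$. A literal is an atom (positive) or the negation of an atom (negative). *)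

(* Defs.v *)
From mathcomp Require Import all_boot.
From mathcomp Require Import boolp.
Set Implicit Arguments.
Unset Strict Implicit.
Unset Printing Implicit Defensive.

(* Sorted tuples: [hlist F [:: s1; ...; sn]] is F s1 * ... * F sn. *)
Inductive hlist (S : Type) (F : S -> Type) : seq S -> Type :=
| hnil : hlist F [::]
| hcons s w : F s -> hlist F w -> hlist F (s :: w).
Arguments hnil {S F}.
Arguments hcons {S F s w}.

Definition hhd (S : Type) (F : S -> Type) s w (v : hlist F (s :: w)) : F s :=
  match v with hcons _ _ a _ => a end.

Definition htl (S : Type) (F : S -> Type) s w (v : hlist F (s :: w)) :
  hlist F w :=
  match v with hcons _ _ _ v' => v' end.

Fixpoint hmap (S : Type) (F G : S -> Type) (f : forall s, F s -> G s) w
    (v : hlist F w) : hlist G w :=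
  match v with
  | hnil => hnil
  | hcons _ _ a v' => hcons (f _ a) (hmap f v')
  end.

Lemma hlist0 (S : Type) (F : S -> Type) (v : hlist F [::]) : v = hnil.
Proof.
exact: (match v as u in hlist _ w return
    match w return hlist F w -> Prop with
    | [::] => fun u => u = hnil
    | _ => fun _ => True
    end u
  with hnil => erefl | hcons _ _ _ _ => I end).
Qed.

Lemma hlistS (S : Type) (F : S -> Type) s w (v : hlist F (s :: w)) :
  v = hcons (hhd v) (htl v).
Proof.
exact: (match v as u in hlist _ w0 return
    match w0 return hlist F w0 -> Prop with
    | [::] => fun _ => True
    | _ :: _ => fun u => u = hcons (hhd u) (htl u)
    end u
  with hnil => I | hcons _ _ _ _ => erefl end).
Qed.

Inductive hrel (S : Type) (F : S -> Type) (R : forall s, F s -> F s -> Prop) :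
  forall w, hlist F w -> hlist F w -> Prop :=
| hrel_nil : hrel R hnil hnil
| hrel_cons s w (a b : F s) (u v : hlist F w) :
    R s a b -> hrel R u v -> hrel R (hcons a u) (hcons b v).

Inductive hexists (S : Type) (F : S -> Type) (P : forall s, F s -> Prop) :
  forall w, hlist F w -> Prop :=
| hexists_hd s w (a : F s) (v : hlist F w) : P s a -> hexists P (hcons a v)
| hexists_tl s w (a : F s) (v : hlist F w) :
    hexists P v -> hexists P (hcons a v).

(* [rsym w] collects the predicate symbols of rank w other than identity;
   [has_eq s] says that the identity predicate = : s s belongs to the
   signature. *)
Record signature := Signature {
  sorts : Type;
  fsym : seq sorts -> sorts -> Type;
  rsym : seq sorts -> Type;
  has_eq : sorts -> bool;
  rsym_nonempty : forall w, rsym w -> w <> [::]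
}.
Arguments fsym {_}.
Arguments rsym {_}.
Arguments has_eq {_}.

Inductive psym (Omega : signature) : seq (sorts Omega) -> Type :=
| Rel w : rsym w -> psym w
| Ident s : has_eq s -> psym [:: s; s].
Arguments Ident {Omega s}.

(* Typed de Bruijn variables.  Terms and formulas carry the list of sorts of
   their free variables, so that structures with empty carriers cause no
   trouble: a valuation only assigns values to the variables in scope. *)
Inductive var (S : Type) : seq S -> S -> Type :=
| vz s Gamma : var (s :: Gamma) s
| vs s s' Gamma : var Gamma s -> var (s' :: Gamma) s.

Definition hget (S : Type) (F : S -> Type) : forall Gamma s,
    var Gamma s -> hlist F Gamma -> F s :=
  fix get Gamma s (x : var Gamma s) : hlist F Gamma -> F s :=
  match x in var G s0 return hlist F G -> F s0 with
  | vz _ _ => fun v => hhd v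
  | vs _ _ _ y => fun v => get _ _ y (htl v)
  end.

Section Syntax.
Variable Omega : signature.
Notation ctx := (seq (sorts Omega)).

Inductive term (Gamma : ctx) : sorts Omega -> Type :=
| Var s : var Gamma s -> term Gamma s
| App w s : fsym w s -> hlist (term Gamma) w -> term Gamma s.

Definition ground : sorts Omega -> Type := term [::].

Inductive occurs (Gamma : ctx) s (x : var Gamma s) :
  forall s', term Gamma s' -> Prop :=
| occurs_var : occurs x (Var x)
| occurs_app w s' (f : fsym w s') ts :
    hexists (occurs x) ts -> occurs x (App f ts).

Record atom (Gamma : ctx) := Atom {
  arank : ctx;
  apred : psym arank;
  aargs : hlist (term Gamma) arank
}.

Definition ground_atom := atom [::].

Inductive literal (Gamma : ctx) :=
| Pos of atom Gamma
| Neg of atom Gamma.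

Definition latom Gamma (L : literal Gamma) : atom Gamma :=
  match L with Pos a => a | Neg a => a end.

Definition occurs_literal Gamma s (x : var Gamma s) (L : literal Gamma) :=
  hexists (occurs x) (aargs (latom L)).

Inductive formula (Gamma : ctx) : Type :=
| FAtom of atom Gamma
| FTrue
| FFalse
| FNot of formula Gamma
| FAnd of formula Gamma & formula Gamma
| FOr of formula Gamma & formula Gamma
| FAll s of formula (s :: Gamma)
| FEx s of formula (s :: Gamma).

Definition sentence := formula [::].

Definition formula_of_literal Gamma (L : literal Gamma) : formula Gamma :=
  match L with Pos a => FAtom a | Neg a => FNot (FAtom a) end.

Inductive quantifier := Univ | Exis.

(* A quantifier prefix (Q1 x1 : s1) ... (Qk xk : sk) is the list of the pairs
   (Qq, sq), outermost first. *)
Definition qprefix := seq (quantifier * sorts Omega).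

Fixpoint bind_ctx (pre : qprefix) (Gamma : ctx) : ctx :=
  match pre with
  | [::] => Gamma
  | (_, s) :: pre' => bind_ctx pre' (s :: Gamma)
  end.

Fixpoint quantify (pre : qprefix) : forall Gamma,
    formula (bind_ctx pre Gamma) -> formula Gamma :=
  match pre return forall Gamma, formula (bind_ctx pre Gamma) -> formula Gamma
  with
  | [::] => fun _ phi => phi
  | (Univ, s) :: pre' => fun Gamma phi => FAll (quantify (Gamma := s :: Gamma) phi)
  | (Exis, s) :: pre' => fun Gamma phi => FEx (quantify (Gamma := s :: Gamma) phi)
  end.

Definition prefix_ctx (pre : qprefix) : ctx := bind_ctx pre [::].

Definition prenex_dnf (pre : qprefix) (m : nat) (n : 'I_m -> nat)
    (L : forall i : 'I_m, 'I_(n i) -> literal (prefix_ctx pre)) : sentence :=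
  quantify (pre := pre) (Gamma := [::])
    (\big[@FOr _/FFalse _]_(i < m) \big[@FAnd _/FTrue _]_(j < n i)
        formula_of_literal (L i j)).

Definition gsubst (Gamma : ctx) := hlist ground Gamma.

Fixpoint subst Gamma (sigma : gsubst Gamma) s (t : term Gamma s) : ground s :=
  match t with
  | Var _ x => hget x sigma
  | App _ _ f ts => App f (hmap (subst sigma) ts)
  end.

End Syntax.

Arguments ground {Omega}.
Arguments Var {Omega Gamma s}.
Arguments App {Omega Gamma w s}.
Arguments Atom {Omega Gamma arank}.
Arguments Pos {Omega Gamma}.
Arguments Neg {Omega Gamma}.

Section Semantics.
Variable Omega : signature.

Record structure := Structure {
  carrier :> sorts Omega -> Type;
  fint : forall w s, fsym w s -> hlist carrier w -> carrier s;
  rint : forall w, rsym w -> hlist carrier w -> Prop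
}.

Definition pint (A : structure) w (P : psym w) : hlist A w -> Prop :=
  match P in psym w0 return hlist A w0 -> Prop with
  | Rel _ R => rint R
  | Ident _ _ => fun v => hhd v = hhd (htl v)
  end.

Fixpoint eval (A : structure) Gamma (v : hlist A Gamma) s
    (t : term Gamma s) : A s :=
  match t with
  | Var _ x => hget x v
  | App _ _ f ts => fint f (hmap (eval v) ts)
  end.

Definition sat_atom (A : structure) Gamma (v : hlist A Gamma)
    (a : atom Gamma) : Prop :=
  pint (apred a) (hmap (eval v) (aargs a)).

Fixpoint sat (A : structure) Gamma (v : hlist A Gamma)
    (phi : formula Gamma) : Prop :=
  match phi with
  | FAtom a => sat_atom v a
  | FTrue => True
  | FFalse => False
  | FNot psi => ~ sat v psi
  | FAnd psi chi => sat v psi /\ sat v chi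
  | FOr psi chi => sat v psi \/ sat v chi
  | FAll s psi => forall a : A s, sat (hcons a v) psi
  | FEx s psi => exists a : A s, sat (hcons a v) psi
  end.

Definition models (A : structure) (phi : sentence Omega) : Prop :=
  sat (A := A) hnil phi.

Definition model_of (S : ground_atom Omega -> Prop) (A : structure) : Prop :=
  forall a, S a -> models A (FAtom a).

Definition is_hom (A B : structure) (h : forall s, A s -> B s) : Prop :=
  (forall w s (f : fsym w s) (v : hlist A w),
      h s (fint f v) = fint f (hmap h v)) /\
  (forall w (P : psym w) (v : hlist A w), pint P v -> pint P (hmap h v)).

End Semantics.

Section Initial.
Variable Omega : signature.
Variable S : ground_atom Omega -> Prop.

Record is_congruence (R : forall s, ground (Omega := Omega) s -> ground s -> Prop)
  : Prop := IsCongruence {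
  congr_refl : forall s t, R s t t;
  congr_sym : forall s t u, R s t u -> R s u t;
  congr_trans : forall s t u v, R s t u -> R s u v -> R s t v;
  congr_app : forall w s (f : fsym w s) ts us,
    hrel R ts us -> R s (App f ts) (App f us)
}.

Definition contains_equations
    (R : forall s, ground (Omega := Omega) s -> ground s -> Prop) : Prop :=
  forall s (e : has_eq s) (t u : ground s),
    S (Atom (Ident e) (hcons t (hcons u hnil))) -> R s t u.

Definition cong s (t u : ground s) : Prop :=
  forall R, is_congruence R -> contains_equations R -> R s t u.

Definition icarrier s : Type :=
  {C : ground s -> Prop | exists t, C = cong t}.

Definition cls s (t : ground s) : icarrier s :=
  exist _ (cong t) (ex_intro _ t erefl).

Definition crepr s (C : icarrier s) : ground s := sval (cid (svalP C)).

(* [fint_initial] below shows that f^I maps the classes of t1, ..., tn to the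
   class of f(t1, ..., tn).  Identity is interpreted as identity of classes,
   as in every structure. *)
Definition initial : structure Omega := @Structure Omega icarrier
  (fun w s (f : fsym w s) cs => cls (App f (hmap crepr cs)))
  (fun w (P : rsym w) cs =>
     exists2 ts : hlist ground w, hmap cls ts = cs & S (Atom (Rel P) ts)).

Lemma cong_congruence : is_congruence cong.
Proof.
split.
- by move=> s t R cR _; exact: congr_refl.
- by move=> s t u tu R cR eR; apply: congr_sym => //; exact: tu.
- move=> s t u v tu uv R cR eR.
  by apply: (congr_trans cR (u := u)); [exact: tu | exact: uv].
- move=> w s f ts us tsus R cR eR; apply: congr_app => //.
  by elim: tsus => [|s0 w0 a b u v ab _ IH]; constructor => //; exact: ab.
Qed.

Lemma cls_eqP s (t u : ground s) : cls t = cls u <-> cong t u.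
Proof.
have cC := cong_congruence; split=> [[tu]|tu].
  by rewrite tu; exact: congr_refl.
apply: eq_exist => /=; apply/funext => v; apply/propext; split=> H.
  exact: (congr_trans cC) (congr_sym cC tu) H.
exact: (congr_trans cC) tu H.
Qed.

Lemma creprK s : cancel (@crepr s) (@cls s).
Proof.
move=> C; rewrite /crepr; case: cid => t /= Ct.
by case: C Ct => D D_cls /= Ct; exact: eq_exist.
Qed.

Lemma fint_initial w s (f : fsym w s) (ts : hlist ground w) :
  fint (s0 := initial) f (hmap cls ts) = cls (App f ts).
Proof.
apply/cls_eqP; apply: (congr_app cong_congruence).
elim: ts => [|s0 w0 a v IH] /=; constructor => //.
by apply/cls_eqP; rewrite creprK.
Qed.

Lemma initial_homE (A : structure Omega) (h : forall s, initial s -> A s) :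
  is_hom h -> forall s (t : ground s), h s (cls t) = eval (A := A) hnil t.
Proof.
move=> [hf _]; fix IH 2 => s t; case: t => [s0 x|w s0 f ts].
  by inversion x.
rewrite -fint_initial hf /=; congr fint.
by elim: ts => //= s1 w1 a v ->; rewrite IH.
Qed.

Lemma eval_initial s (t : ground s) : eval (A := initial) hnil t = cls t.
Proof.
rewrite -(initial_homE (h := fun _ c => c)) //.
have hmap_id w (v : hlist icarrier w) : hmap (fun _ c => c) v = v.
  by elim: v => //= s0 w0 a v ->.
by split=> [w s0 f v|w P v]; rewrite hmap_id.
Qed.

Lemma initial_model : model_of S initial.
Proof.
move=> [w P ts] Sa; rewrite /models /= /sat_atom /=.
have -> : hmap (@eval _ initial _ hnil) ts = hmap cls ts.
  by elim: (ts) => //= s w0 t v ->; rewrite eval_initial.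
case: P ts Sa => [w0 R|s e] ts Sa /=; first by exists ts.
set v := htl ts; have Ets : ts = hcons (hhd ts) (hcons (hhd v) hnil).
  by rewrite /v -(hlist0 (htl (htl ts))) -!hlistS.
rewrite Ets /=; apply/cls_eqP => Q cQ; apply; by rewrite -Ets.
Qed.

Lemma eval_cong (A : structure Omega) s (t u : ground s) :
  model_of S A -> cong t u -> eval (A := A) hnil t = eval (A := A) hnil u.
Proof.
move=> AS tu.
apply: (tu (fun s0 t0 u0 => eval (A := A) hnil t0 = eval (A := A) hnil u0)).
- split=> //= [s0 t0 u0 v -> //|w s0 f ts us tsus] /=; congr fint.
  by elim: tsus => //= s1 w1 a b v v' -> _ ->.
- by move=> s0 e t0 u0 /AS.
Qed.

Lemma initial_hom_exists_unique (A : structure Omega) : model_of S A ->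
  exists! h : forall s, initial s -> A s, is_hom h.
Proof.
move=> AS; exists (fun s (C : initial s) => eval (A := A) hnil (crepr C)).
have evK s (t : ground s) :
    eval (A := A) hnil (crepr (cls t)) = eval (A := A) hnil t.
  by apply: eval_cong => //; apply/cls_eqP; rewrite creprK.
split=> [|h /initial_homE hE]; last first.
  by apply: functional_extensionality_dep => s; apply/funext => C; rewrite -hE creprK.
split=> [w s f v|w [w0 R|s e] v].
- rewrite evK /=; congr fint.
  by elim: v => //= s0 w0 a v ->.
- move=> [ts <- /AS]; rewrite /models /= /sat_atom /=.
  set x := hmap _ _; set y := hmap _ _; suff -> : x = y by [].
  by rewrite {}/x {}/y; elim: ts => //= s1 w1 a v' ->; rewrite evK.
- by rewrite /= (hlistS v) (hlistS (htl v)) /= => ->.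
Qed.

End Initial.
Arguments initial {Omega}.
Arguments cls {Omega} S {s}.

(* Main.v *)
Require Import Defs.
From mathcomp Require Import all_boot.

(** A homomorphism [h] commutes with the evaluation of terms, so it
    preserves atoms under every valuation, and it preserves a negated
    atom as soon as it reflects the atom. Every valuation in the initial
    model is the class of a ground substitution, so hypothesis (b) says
    exactly that [h] reflects the atoms negated in the matrix.
    Preservation passes through an existential quantifier for every map,
    and through a universal one for maps that are onto the quantified
    sort. *)

Set Implicit Arguments.
Unset Strict Implicit.
Unset Printing Implicit Defensive.

Section SortedTuples.
Variable T : Type.

Lemma eq_hmap (F G : T -> Type) (f g : forall s, F s -> G s) :
  (forall s, f s =1 g s) ->
  forall w (v : hlist F w), hmap f v = hmap g v.
Proof. by move=> eq_fg w; elim=> //= s w' a v ->; rewrite eq_fg. Qed.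

Lemma hmap_comp (F G H : T -> Type) (g : forall s, G s -> H s)
    (f : forall s, F s -> G s) w (v : hlist F w) :
  hmap (fun s => g s \o f s) v = hmap g (hmap f v).
Proof. by elim: v => //= s w' a v ->. Qed.

Lemma hmapK (F G : T -> Type) (f : forall s, F s -> G s)
    (g : forall s, G s -> F s) :
  (forall s, cancel (f s) (g s)) ->
  forall w (v : hlist F w), hmap g (hmap f v) = v.
Proof. by move=> fK w; elim=> //= s w' a v ->; rewrite fK. Qed.

Lemma hget_hmap (F G : T -> Type) (f : forall s, F s -> G s) w s
    (x : var w s) (v : hlist F w) :
  hget x (hmap f v) = f s (hget x v).
Proof.
by elim: x v => [s' w' v|s1 s2 w' x IHx v]; rewrite (hlistS v) //=; apply: IHx.
Qed.

End SortedTuples.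

Lemma eval_unique (Omega : signature) (A : structure Omega) Gamma
    (v : hlist A Gamma) (f : forall s, term Gamma s -> A s) :
  (forall s (x : var Gamma s), f s (Var x) = hget x v) ->
  (forall w s (g : Defs.fsym w s) (ts : hlist (term Gamma) w),
     f s (App g ts) = fint g (hmap f ts)) ->
  forall s (t : term Gamma s), f s t = eval v t.
Proof.
move=> fVar fApp; fix IHt 2 => s; case=> [s' x|w s' g ts]; first exact: fVar.
by rewrite fApp /=; congr fint; elim: ts => //= s1 w1 t ts ->; rewrite IHt.
Qed.

Section Preservation.
Variables (Omega : signature) (A B : structure Omega).
Variable h : forall s, A s -> B s.

Definition preserves Gamma (phi : formula Gamma) : Prop :=
  forall v : hlist A Gamma, sat v phi -> sat (hmap h v) phi.

Definition reflects Gamma (phi : formula Gamma) : Prop :=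
  forall v : hlist A Gamma, sat (hmap h v) phi -> sat v phi.

Lemma preserves_not Gamma (phi : formula Gamma) :
  reflects phi -> preserves (FNot phi).
Proof. by move=> phiR v; apply/contra_not/phiR. Qed.

Lemma preserves_big_and Gamma (I : Type) (r : seq I) (P : pred I)
    (phi : I -> formula Gamma) :
  (forall i, P i -> preserves (phi i)) ->
  preserves (\big[@FAnd _ _/FTrue _]_(i <- r | P i) phi i).
Proof.
by apply: big_ind => // psi chi psiP chiP v [/psiP psiv /chiP chiv]; split.
Qed.

Lemma preserves_big_or Gamma (I : Type) (r : seq I) (P : pred I)
    (phi : I -> formula Gamma) :
  (forall i, P i -> preserves (phi i)) ->
  preserves (\big[@FOr _ _/FFalse _]_(i <- r | P i) phi i).
Proof.
by apply: big_ind => // psi chi psiP chiP v [/psiP|/chiP]; [left|right].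
Qed.

Lemma preserves_exists Gamma s (phi : formula (s :: Gamma)) :
  preserves phi -> preserves (FEx phi).
Proof. by move=> phiP v [a /phiP phia]; exists (h a). Qed.

Lemma preserves_forall Gamma s (phi : formula (s :: Gamma)) :
  (forall b, exists a, @h s a = b) -> preserves phi -> preserves (FAll phi).
Proof.
by move=> h_onto phiP v phiv b; have [a <-] := h_onto b; apply: phiP (phiv a).
Qed.

Lemma preserves_quantify (pre : qprefix Omega) :
  (forall q s, onth pre q = Some (Univ, s) ->
     forall b, exists a, @h s a = b) ->
  forall Gamma (phi : formula (bind_ctx pre Gamma)),
  preserves phi -> preserves (quantify phi).
Proof.
elim: pre => [//|[Q s] pre IHpre] h_onto Gamma phi phiP.
have innerP : preserves (quantify (Gamma := s :: Gamma) phi).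
  by apply: IHpre phiP => q; apply: (h_onto q.+1).
case: Q h_onto phi innerP {phiP} => h_onto phi innerP.
  by apply: preserves_forall innerP; apply: (h_onto 0).
exact: preserves_exists.
Qed.

Hypothesis h_hom : is_hom h.

Lemma hom_eval Gamma (v : hlist A Gamma) s (t : term Gamma s) :
  h (eval v t) = eval (hmap h v) t.
Proof.
move: s t; apply: eval_unique => [s x|w s f ts] /=; first by rewrite hget_hmap.
by rewrite h_hom.1 -hmap_comp.
Qed.

Lemma hmap_eval_hom Gamma (v : hlist A Gamma) w (ts : hlist (term Gamma) w) :
  hmap (eval (hmap h v)) ts = hmap h (hmap (eval v) ts).
Proof. by rewrite -hmap_comp; apply: eq_hmap => s t; rewrite /= hom_eval. Qed.

Lemma preserves_atom Gamma (a : atom Gamma) : preserves (FAtom a).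
Proof. by move=> v; rewrite /= /sat_atom hmap_eval_hom; apply: h_hom.2. Qed.

End Preservation.

Section InitialModel.
Variables (Omega : signature) (S : ground_atom Omega -> Prop).

Lemma eval_hmap_cls Gamma (sigma : gsubst Gamma) s (t : term Gamma s) :
  eval (A := initial S) (hmap (@cls _ S) sigma) t = cls S (subst sigma t).
Proof.
apply/esym; move: s t; apply: eval_unique => [s x|w s f ts].
  by rewrite hget_hmap.
by rewrite -[LHS]fint_initial -hmap_comp.
Qed.

Lemma reflects_atom_initial (A : structure Omega)
    (h : forall s, initial S s -> A s) (h_hom : is_hom h)
    Gamma w (P : psym w) (ts : hlist (term Gamma) w) :
  (forall sigma : gsubst Gamma,
     let c := hmap (fun s t => cls S (subst sigma t)) ts in
     pint P (hmap h c) -> pint (A := initial S) P c) ->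
  reflects h (FAtom (Atom P ts)).
Proof.
move=> ground_reflects v.
rewrite -[v](hmapK (@creprK _ S)); set sigma := hmap _ v.
rewrite /= /sat_atom (hmap_eval_hom h_hom) (eq_hmap (eval_hmap_cls sigma)).
exact: ground_reflects.
Qed.

End InitialModel.

Theorem theorem1 (Omega : signature) (S : ground_atom Omega -> Prop)
    (pre : qprefix Omega) (m : nat) (n : 'I_m -> nat)
    (L : forall i : 'I_m, 'I_(n i) -> literal (prefix_ctx pre))
    (all_occur : forall s (x : var (prefix_ctx pre) s),
       exists (i : 'I_m) (j : 'I_(n i)), occurs_literal x (L i j))
    (A : structure Omega) (A_model : model_of S A)
    (h : forall s, initial S s -> A s) (h_hom : is_hom h)
    (surj : forall (q : nat) (s : sorts Omega),
       onth pre q = Some (Univ, s) -> forall a : A s, exists c, h s c = a)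
    (neg : forall (i : 'I_m) (j : 'I_(n i)) w (P : psym w)
         (ts : hlist (term (prefix_ctx pre)) w),
       L i j = Neg (Atom P ts) ->
       forall sigma : gsubst (prefix_ctx pre),
         let c := hmap (fun s t => cls S (subst sigma t)) ts in
         pint P (hmap h c) -> pint (A := initial S) P c) :
  models (initial S) (prenex_dnf L) -> models A (prenex_dnf L).
Proof.
have literalP i j : preserves h (formula_of_literal (L i j)).
  case Lij: (L i j) => [a|[w P ts]]; first exact: preserves_atom.
  by apply/preserves_not/reflects_atom_initial => // sigma; apply: neg Lij _.
suff dnfP : preserves h (prenex_dnf L) by exact: dnfP hnil.
apply: preserves_quantify => //.
by apply: preserves_big_or => i _; apply: preserves_big_and.
Qed.
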